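(* For $n\ge1$, $$|\Pi_n(12/34)|=\sum_{k=0}^{\lfloor n/2\rfloor}\left[k!\binom{n}{2k}+\sum_{\ell=3}^{n-2k}\binom{n}{2k+\ell}k!\,(k+1)^2\right],$$ where an empty inner sum is $0$.
   Context: The standardization of a set partition of a finite set $S\subset\mathbb{Z}_{>0}$ replaces the $i$-th smallest element of $S$ by $i$. A set partition $\pi$ of $[n]$ contains $\tau\vdash[k]$ if for some $S\subseteq[n]$ the standardization of the restriction of $\pi$ to $S$ is $\tau$; otherwise it avoids $\tau$. $\Pi_n(\tau)$ is the set of partitions of $[n]$ avoiding $\tau$. $12/34$ is the partition of $[4]$ with blocks $\{1,2\},\{3,4\}$. *)

(* Defs.v *)
From mathcomp Require Import all_boot.
Set Implicit Arguments.
Unset Strict Implicit.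
Unset Printing Implicit Defensive.

(* The set [n] = {1, ..., n} is represented by 'I_n, the integer i of [n] being
   the ordinal with value i - 1; only the order of the elements matters. *)

Definition restriction (n : nat) (P : {set {set 'I_n}}) (S : {set 'I_n}) :
    {set {set 'I_n}} :=
  [set B :&: S | B in P] :\ set0.

Definition rank_in (n : nat) (S : {set 'I_n}) (x : 'I_n) : nat :=
  #|[set y in S | y < x]|.

(* Meaningful for k = #|S|, when rank_in S maps S onto {0, ..., k - 1};
   [contains] only uses it in that case. *)
Definition standardization (n k : nat) (S : {set 'I_n})
    (Q : {set {set 'I_n}}) : {set {set 'I_k}} :=
  [set [set i : 'I_k | [exists x in B, rank_in S x == i]] | B : {set 'I_n} in Q].

Definition contains (n k : nat) (P : {set {set 'I_n}})
    (tau : {set {set 'I_k}}) : bool :=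
  [exists S : {set 'I_n},
     (#|S| == k) && (standardization k S (restriction P S) == tau)].

Definition avoiding_partitions (n k : nat) (tau : {set {set 'I_k}}) :
    {set {set {set 'I_n}}} :=
  [set P : {set {set 'I_n}} | partition P [set: 'I_n] & ~~ contains P tau].

Definition partition_12_34 : {set {set 'I_4}} :=
  [set [set inord 0; inord 1]; [set inord 2; inord 3]].

(* Main.v *)
(* Encode a partition by the map g sending each element to the minimum of its
   block. Avoiding 12/34 means: a < b < c < d, g a = g b and g c = g d imply
   g a = g c. Let D be the set of x with g x <> x, O = g(D), k = #|O| and
   U = O u D, the union of the non-singleton blocks. Avoidance forces O to be
   the k smallest elements of U, forces g to be a bijection from the k largest
   elements of U onto O, and forces g to be constant on the remaining middle
   elements M; conversely all such g avoid 12/34. For fixed U and k this gives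
   k! maps when M is empty (#|U| = 2k) and k! * k maps otherwise. In the second
   case the arcs of the theorem are the k - 1 blocks of size 2, so that its
   summand is k'! (k' + 1)^2 = k! * k with k' = k - 1. *)
Require Import Defs.
From mathcomp Require Import all_boot zify.
Set Implicit Arguments.
Unset Strict Implicit.
Unset Printing Implicit Defensive.

(** * Counting maps that are injective on a set and prescribed off it *)

(** Extending by [h] is a bijection from the injections of the subtype of [C] into [A] onto these
    maps. The free choice of [h] lets one count serve both an empty and a non-empty middle layer. *)
Lemma card_inj_extensions (aT rT : finType) (h : {ffun aT -> rT})
    (C : {set aT}) (A : {set rT}) :
  #|[set g : {ffun aT -> rT} | [&& [forall x in C, g x \in A],
       [forall x in ~: C, g x == h x] & dinjectiveb g (mem C)]]| =
  #|A| ^_ #|C|.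
Proof.
pose S := {x | x \in C}.
pose ext (f : {ffun S -> rT}) : {ffun aT -> rT} :=
  [ffun x => if insub x is Some u then f u else h x].
have extV f (u : S) : ext f (val u) = f u by rewrite ffunE valK.
have extN f x : x \notin C -> ext f x = h x.
  by move=> xC; rewrite ffunE insubN.
have ext_inj : injective ext.
  by move=> f f' ff'; apply/ffunP=> u; rewrite -!extV ff'.
have <- : #|{: S}| = #|C| by rewrite card_sig; apply: eq_card => x.
rewrite -(card_inj_ffuns_on S (mem A)) -(card_imset _ ext_inj).
apply: eq_card => g; rewrite inE; apply/idP/imsetP.
  case/and3P=> /forall_inP gA /forall_inP gh /dinjectiveP ginj.
  exists [ffun u : S => g (val u)].
    rewrite inE; apply/andP; split.
      by apply/ffun_onP => u; rewrite ffunE; apply/gA/(valP u).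
    apply/injectiveP => u v; rewrite !ffunE => guv.
    exact/val_inj/ginj/guv/(valP v)/(valP u).
  apply/ffunP=> x; have [xC|xC] := boolP (x \in C).
    by rewrite -[x]/(val (Sub x xC : S)) extV ffunE.
  by rewrite extN //; apply/eqP/gh; rewrite inE.
case=> f; rewrite inE => /andP[/ffun_onP fA /injectiveP finj] ->.
apply/and3P; split.
- by apply/forall_inP=> x xC; rewrite -[x]/(val (Sub x xC : S)) extV; apply: fA.
- by apply/forall_inP=> x; rewrite inE => xC; rewrite extN.
apply/dinjectiveP=> x y xC yC.
rewrite -[x]/(val (Sub x xC : S)) -[y]/(val (Sub y yC : S)) !extV.
by move/finj => ->.
Qed.

(** * Initial segments of sets of ordinals *)

Section Ordered.
Variable n : nat.
Implicit Types (U A B C M D : {set 'I_n}) (g : {ffun 'I_n -> 'I_n}).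

Definition below A B := {in A & B, forall x y : 'I_n, x < y}.

Lemma exists_initial_segment U k : k <= #|U| ->
  exists A, [/\ A \subset U, #|A| = k & below A (U :\: A)].
Proof.
elim: k => [|k IH] kU.
  by exists set0; split=> [||x y]; rewrite ?sub0set ?cards0 ?in_set0.
have [A [AU cA lA]] := IH (ltnW kU).
have [x xD] : exists x, x \in U :\: A.
  apply/set0Pn; rewrite -card_gt0 cardsD (setIidPr AU) cA; lia.
case: (arg_minnP (fun y : 'I_n => y : nat) xD) => m mD mmin.
have /setDP[mU mA] : m \in U :\: A by [].
exists (m |: A); split.
- by rewrite subUset sub1set mU.
- by rewrite cardsU1 mA cA.
move=> u v; rewrite !inE negb_or -andbA => uA /and3P[vm vA vU].
have vD : v \in U :\: A by rewrite inE vA.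
case/orP: uA => [/eqP->|uA]; last exact: lA.
by rewrite ltn_neqAle (inj_eq val_inj) eq_sym vm mmin.
Qed.

(** An element of [A] outside [B] and one of [B] outside [A] would each be less than the other. So
    one set contains the other, and equal size makes them equal. *)
Lemma initial_segment_uniq U A B : A \subset U -> B \subset U ->
  below A (U :\: A) -> below B (U :\: B) -> #|A| = #|B| -> A = B.
Proof.
move=> AU BU lA lB cAB; apply/eqP.
have [sAB|] := boolP (A \subset B); first by rewrite eqEcard sAB cAB /=.
case/subsetPn=> x xA xB; rewrite eq_sym eqEcard cAB leqnn andbT.
apply/subsetP=> y yB; apply/negPn/negP=> yA.
have xy : x < y by apply: lA; rewrite // inE yA (subsetP BU).
have yx : y < x by apply: lB; rewrite // inE xB (subsetP AU).
by have := ltn_trans xy yx; rewrite ltnn.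
Qed.

(** * Block-minimum maps, their openers and their support *)

Definition avoids_split_pairs g :=
  [forall a : 'I_n, forall b : 'I_n, forall c : 'I_n, forall d : 'I_n,
     [&& a < b, b < c, c < d, g a == g b & g c == g d] ==> (g a == g c)].

Lemma avoids_split_pairsP g :
  reflect (forall a b c d : 'I_n, a < b -> b < c -> c < d ->
             g a = g b -> g c = g d -> g a = g c)
          (avoids_split_pairs g).
Proof.
apply: (iffP idP) => [H a b c d ab bc cd gab gcd | H].
  move/forallP: H => /(_ a)/forallP/(_ b)/forallP/(_ c)/forallP/(_ d).
  by rewrite ab bc cd gab gcd !eqxx /= => /eqP.
apply/forallP=> a; apply/forallP=> b; apply/forallP=> c; apply/forallP=> d.
apply/implyP => /and5P[ab bc cd /eqP gab /eqP gcd].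
by apply/eqP; apply: (H a b c d).
Qed.

(* Such maps are exactly those sending each element to the minimum of its block
   in some partition, namely the partition into fibers of [g]. *)
Definition is_block_min g := [forall x, (g x <= x) && (g (g x) == g x)].

Lemma is_block_minP g :
  reflect ((forall x, g x <= x) /\ (forall x, g (g x) = g x)) (is_block_min g).
Proof.
apply: (iffP forallP) => [H|[H1 H2] x]; last by rewrite H1 H2 eqxx.
by split=> x; case/andP: (H x) => // _ /eqP.
Qed.

Definition avoiding_maps :=
  [set g | is_block_min g && avoids_split_pairs g].

(** The sets D, O and U of the overview are [nonminima], [openers] and [support]. For a
    block-minimum map, the openers are the minima of the non-singleton blocks. *)
Definition nonminima g := [set x | g x != x].
Definition openers g := g @: nonminima g.
Definition support g := openers g :|: nonminima g.

Lemma openers_fixed g o : is_block_min g -> o \in openers g -> g o = o.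
Proof. by case/is_block_minP => _ gg /imsetP[x _ ->]. Qed.

(** Write [o = g e]. If [d < o], then [g d < d < o < e] are two pairs, each inside a fiber, so
    avoidance forces [g d = o], contradicting [g d < o]. *)
Lemma openers_below_nonminima g : g \in avoiding_maps ->
  below (openers g) (nonminima g).
Proof.
rewrite inE => /andP[gm /avoids_split_pairsP av] o d oO.
have go := openers_fixed gm oO.
case/is_block_minP: gm => gle gg; case/imsetP: oO => e; rewrite !inE => ge oe gd.
rewrite ltnNge leq_eqVlt; apply/negP => /orP[/eqP/val_inj do_|do_].
  by rewrite do_ go eqxx in gd.
have gdd : g d < d by rewrite ltn_neqAle gle (inj_eq val_inj) gd.
have oe' : o < e by rewrite ltn_neqAle oe gle (inj_eq val_inj) ge.
have := av _ _ _ _ gdd do_ oe' (gg d) (etrans go oe).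
by rewrite gg go => E; rewrite E ltnNge (ltnW do_) in gdd.
Qed.

(** Openers are fixed by [g], hence disjoint from the non-minima, of which they are the image. *)
Lemma double_card_openers_le g : is_block_min g ->
  2 * #|openers g| <= #|support g|.
Proof.
move=> gm; rewrite cardsU (_ : _ :&: _ = set0) ?cards0 ?subn0.
  by rewrite mul2n -addnn leq_add2l leq_imset_card.
apply/setP=> x; rewrite inE [RHS]inE inE; apply/negP=> /andP[/(openers_fixed gm)->].
by rewrite eqxx.
Qed.

(** * Avoiding maps with a given support cut into three layers *)

Definition layered_maps A M C :=
  [set g : {ffun 'I_n -> 'I_n} | [&& [forall x in ~: (M :|: C), g x == x],
     [forall x in M :|: C, g x \in A], dinjectiveb g (mem C) &
     [forall x in M, forall y in M, g x == g y]]].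

(** A non-minimum and its image form a first pair of the pattern, so a later collision of [g] must
    share their value. With only [#|C|] openers available this forces injectivity on [C], and then
    constancy on [M]. *)
Lemma avoiding_maps_layered A M C :
  below A M -> below A C -> below M C -> #|A| = #|C| ->
  [set g in avoiding_maps | (support g == A :|: (M :|: C)) &&
                            (#|openers g| == #|A|)] = layered_maps A M C.
Proof.
move=> AM AC MC cAC.
have AMC x y : x \in A -> y \in M :|: C -> x < y.
  by move=> xA; rewrite inE => /orP[]; [apply: AM|apply: AC].
have nAMC x : x \in A -> x \in M :|: C -> False.
  by move=> xA /(AMC _ _ xA); rewrite ltnn.
apply/setP=> g; rewrite inE [in RHS]inE; apply/idP/idP.
  case/and3P=> gav /eqP gU /eqP gO.
  have OD := openers_below_nonminima gav.
  (* Both are initial segments of the support and have the same size. *)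
  have OA : openers g = A.
    apply: (@initial_segment_uniq (support g)) => //.
    - exact: subsetUl.
    - by rewrite gU subsetUl.
    - move=> x y xO; rewrite inE in_setU => /andP[yO]; rewrite (negPf yO) => yD.
      exact: OD.
    - move=> x y xA; rewrite gU inE in_setU => /andP[yA]; rewrite (negPf yA).
      exact: AMC.
  have DE : nonminima g = M :|: C.
    apply/setP=> x; move/setP/(_ x): gU; rewrite /support OA in_setU [in RHS]in_setU.
    case: (boolP (x \in A)) => // xA _.
    rewrite [LHS](_ : _ = false); last first.
      by apply/negP=> xD; rewrite OA in OD; have := OD x x xA xD; rewrite ltnn.
    by apply/esym/negP=> /(nAMC _ xA).
  move: gav; rewrite inE => /andP[gm /avoids_split_pairsP av].
  case/is_block_minP: gm => gle gg.
  have gD x : x \in M :|: C -> g x < x.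
    rewrite -DE inE => gx; by rewrite ltn_neqAle (inj_eq val_inj) gx gle.
  (* Avoidance is applied to [g b < b < c < d]. *)
  have prop (b c d : 'I_n) : b \in M :|: C -> b < c -> c < d -> g c = g d -> g b = g c.
    by move=> /gD gb bc cd gcd; rewrite -(av _ _ _ _ gb bc cd (gg b) gcd) gg.
  have ginjlt (c d : 'I_n) : c \in C -> d \in C -> c < d -> g c <> g d.
    move=> cC dC cd gcd.
    (* Given the collision, every opener is a value on [C] without [c]: non-minima before [c] take
       the value [g d] by [prop], those after [c] lie in [C], and [d] replaces [c] itself. This
       leaves too few points for [#|A| = #|C|] openers. *)
    have : A \subset g @: (C :\ c).
      rewrite -OA; apply/subsetP=> o /imsetP[x]; rewrite DE => xD ->.
      case: (ltngtP x c) => [xc|cx|/val_inj->].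
      - rewrite (prop x c d) // gcd; apply: imset_f.
        by rewrite !inE dC andbT; apply: contraTneq cd => ->; rewrite ltnn.
      - apply: imset_f; rewrite !inE.
        have -> : x != c by apply: contraTneq cx => ->; rewrite ltnn.
        move: xD; rewrite inE => /orP[xM|//].
        by have := MC x c xM cC; rewrite ltnNge (ltnW cx).
      - rewrite gcd; apply: imset_f.
        by rewrite !inE dC andbT; apply: contraTneq cd => ->; rewrite ltnn.
    move/subset_leq_card; rewrite cAC (cardsD1 c C) cC add1n.
    by move/leq_trans/(_ (leq_imset_card _ _)); rewrite ltnn.
  have ginj : {in C &, injective g}.
    move=> c d cC dC gcd; case: (ltngtP c d) => [cd|dc|/val_inj//].
      by case: (ginjlt c d).
    by case: (ginjlt d c).
  have gC : g @: C = A.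
    apply/eqP; rewrite eqEcard card_in_imset // cAC leqnn andbT -OA /openers DE.
    exact/imsetS/subsetUr.
  have cstlt (x y : 'I_n) : x \in M -> y \in M -> x < y -> g x = g y.
    move=> xM yM xy.
    (* The value [g y] is taken again at some [d] in [C], which lies above [y]; [prop] then carries
       this collision down to [x]. *)
    have : g y \in A by rewrite -OA; apply: imset_f; rewrite DE inE yM.
    rewrite -gC => /imsetP[d dC gyd].
    by apply: (prop x y d) => //; [rewrite inE xM|exact: MC].
  apply/and4P; split.
  - apply/forall_inP=> x; rewrite inE -DE inE negbK => //.
  - by apply/forall_inP=> x xD; rewrite -OA; apply: imset_f; rewrite DE.
  - exact/dinjectiveP.
  - apply/forall_inP=> x xM; apply/forall_inP=> y yM.
    case: (ltngtP x y) => [xy|yx|/val_inj->//].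
      by rewrite (cstlt x y).
    by rewrite (cstlt y x).
(* Converse: a layered map has openers [A] and non-minima [M :|: C], and avoids the pattern. *)
case/and4P=> /forall_inP gfix /forall_inP gA /dinjectiveP ginj /forall_inP gM.
have {}gfix x : x \notin M :|: C -> g x = x.
  by move=> xD; apply/eqP/gfix; rewrite inE.
have gD x : x \in M :|: C -> g x < x by move=> xD; apply: AMC => //; apply: gA.
have DE : nonminima g = M :|: C.
  apply/setP=> x; rewrite inE; have [xD|/gfix->] := boolP (x \in M :|: C).
    by apply: contraTneq (gD _ xD) => ->; rewrite ltnn.
  by rewrite eqxx.
have OA : openers g = A.
  apply/esym/eqP; rewrite eq_sym eqEcard; apply/andP; split.
    by apply/subsetP=> o /imsetP[x]; rewrite DE => xD ->; apply: gA.
  rewrite cAC -(card_in_imset ginj) /openers DE.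
  exact/subset_leq_card/imsetS/subsetUr.
rewrite /support OA DE !eqxx !andbT inE; apply/andP; split.
  apply/is_block_minP; split=> x; have [xD|xD] := boolP (x \in M :|: C).
  - exact/ltnW/gD.
  - by rewrite gfix.
  - by rewrite (gfix (g x)) //; apply/negP; apply/nAMC/gA.
  - by rewrite !(gfix x).
apply/avoids_split_pairsP=> a b c d ab bc cd gab gcd.
(* The later point of a collision is never fixed, so [b] and [d] are non-minima. A fixed [c] would
   equal [g d], an element of [A] above [b]. Injectivity on [C] then pushes [c] down into [M], hence
   also [b], and [g] is constant there. *)
have collide (x y : 'I_n) : x < y -> g x = g y -> y \in M :|: C.
  move=> xy gxy; apply/negPn/negP=> yD.
  have [/gD|xD] := boolP (x \in M :|: C).
    by rewrite gxy (gfix y) // ltnNge (ltnW xy).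
  by move: gxy xy; rewrite !gfix // => ->; rewrite ltnn.
have bD := collide _ _ ab gab; have dD := collide _ _ cd gcd.
have cD : c \in M :|: C.
  apply/negPn/negP=> cD; have : g d \in A by apply: gA.
  by rewrite -gcd gfix // => cA; have := AMC c b cA bD; rewrite ltnNge (ltnW bc).
have cM : c \in M.
  move: cD; rewrite inE => /orP[//|cC].
  move: dD; rewrite inE => /orP[dM|dC].
    by have := MC d c dM cC; rewrite ltnNge (ltnW cd).
  by move: cd; rewrite (ginj c d) // ltnn.
have bM : b \in M.
  move: bD; rewrite inE => /orP[//|bC].
  by have := MC c b cM bC; rewrite ltnNge (ltnW bc).
by rewrite gab; apply/eqP; move/forall_inP: (gM b bM); apply.
Qed.

(** A non-empty [M] contributes the choice of its common value in [A]. Once that is fixed, only an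
    injection of [C] into [A] remains to be chosen. *)
Lemma card_layered_maps A M C : [disjoint M & C] -> #|A| = #|C| ->
  #|layered_maps A M C| = if M == set0 then #|A|`! else #|A|`! * #|A|.
Proof.
move=> dMC cAC; have [M0|[m mM]] := set_0Vmem M.
  rewrite M0 eqxx -ffactnn {2}cAC -(card_inj_extensions [ffun x => x]).
  apply: eq_card => g; rewrite !inE set0U.
  have -> : [forall x in set0, forall y in set0, g x == g y].
    by apply/forall_inP=> x; rewrite inE.
  rewrite andbT andbCA; congr [&& _, _ & _].
  by apply: eq_forallb => x; rewrite ffunE.
rewrite ifN; last by apply/set0Pn; exists m.
rewrite -sum1_card (partition_big (fun g : {ffun 'I_n -> 'I_n} => g m) (mem A)) /=.
  rewrite mulnC -sum_nat_const; apply: eq_bigr => a aA.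
  rewrite sum1dep_card -ffactnn {2}cAC.
  rewrite -(card_inj_extensions [ffun x => if x \in M then a else x]).
  apply: eq_card => g; rewrite !inE; apply/idP/idP.
    case/andP=> /and4P[/forall_inP gfix /forall_inP gA ginj /forall_inP gM] /eqP gm.
    apply/and3P; split=> //.
      by apply/forall_inP=> x xC; apply: gA; rewrite inE xC orbT.
    apply/forall_inP=> x xC; rewrite ffunE; case: ifPn => xM.
      by rewrite -gm; move/forall_inP: (gM x xM); apply.
    by apply: gfix; move: xC; rewrite !inE negb_or xM.
  case/and3P=> /forall_inP gA /forall_inP gh ginj.
  have gM x : x \in M -> g x = a.
    move=> xM; have := gh x; rewrite inE ffunE xM => H; apply/eqP/H.
    by rewrite (disjointFr dMC).
  rewrite gM // eqxx andbT; apply/and4P; split=> //.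
  - apply/forall_inP=> x; rewrite !inE negb_or => /andP[xM xC].
    by have := gh x; rewrite inE ffunE (negPf xM); apply.
  - by apply/forall_inP=> x; rewrite inE => /orP[/gM->//|]; apply: gA.
  - by apply/forall_inP=> x /gM ->; apply/forall_inP=> y /gM ->.
move=> g; rewrite inE => /and4P[_ /forall_inP gA _ _]; apply: gA.
by rewrite inE mM.
Qed.

(** * Counting avoiding maps by support and number of openers *)

(** Here [m] is the size of the support and [k] the number of openers. At [k = 0] the value is 1 for
    [m = 0], from the identity map, and 0 for every larger [m]. *)
Definition fiber_card m k :=
  if m < 2 * k then 0 else if m == 2 * k then k`! else k`! * k.

(** When [2 * k <= #|U|], the set [U] is cut into its [k] smallest elements, a middle of size
    [#|U| - 2 * k] and its [k] largest; the layered count applies. *)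
Lemma card_avoiding_maps_fiber U k :
  #|[set g in avoiding_maps | (support g == U) && (#|openers g| == k)]| =
  fiber_card #|U| k.
Proof.
rewrite /fiber_card; case: ltnP => [Uk|kU].
  apply/eqP; rewrite cards_eq0; apply/eqP/setP=> g; rewrite !inE.
  apply/negP=> /and3P[/andP[gm _] /eqP gU /eqP gk].
  by move: Uk; rewrite -gU -gk ltnNge double_card_openers_le.
have [|A [AU cA lA]] := @exists_initial_segment U k; first lia.
have cUA : #|U :\: A| = #|U| - k by rewrite cardsD (setIidPr AU) cA.
have [|M [MU cM lM]] := @exists_initial_segment (U :\: A) (#|U| - 2 * k).
  by rewrite cUA; lia.
set C := (U :\: A) :\: M in lM.
have cC : #|C| = k by rewrite cardsD (setIidPr MU) cM cUA; lia.
have MCU : M :|: C = U :\: A by rewrite -{1}(setIidPr MU) setID.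
have UE : A :|: (M :|: C) = U by rewrite MCU -{1}(setIidPr AU) setID.
have dMC : [disjoint M & C].
  by rewrite -setI_eq0; apply/eqP/setP=> x; rewrite !inE; case: (x \in M).
have AM : below A M.
  by move=> x y xA yM; apply: lA => //; apply: (subsetP MU).
have AC : below A C.
  by move=> x y xA yC; apply: lA => //; apply: (subsetP (subsetDl _ M)).
have := avoiding_maps_layered AM AC lM; rewrite cA cC UE => -> //.
rewrite card_layered_maps ?cA // -cards_eq0 cM subn_eq0.
by congr (if _ then _ else _); lia.
Qed.

Lemma card_avoiding_maps :
  #|avoiding_maps| =
  \sum_(k < n.+1) \sum_(m < n.+1) 'C(n, m) * fiber_card m k.
Proof.
have cardU (U : {set 'I_n}) : #|U| < n.+1.
  by rewrite ltnS -[X in _ <= X]card_ord max_card.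
(* Maps are sorted by number of openers, then by support, then by support size. All sizes are at
   most [n], so [inord] never falls back to its default. *)
rewrite -sum1_card (partition_big (fun g => inord #|openers g| : 'I_n.+1) predT) //=.
apply: eq_bigr => k _.
rewrite (partition_big (fun g => support g) predT) //=.
under eq_bigr => U _.
  rewrite (_ : \sum_(g | _) 1 = fiber_card #|U| k); first over.
  rewrite -card_avoiding_maps_fiber -sum1dep_card; apply: eq_bigl => g.
  by rewrite -andbA andbCA -(inj_eq val_inj) /= inordK // andbCA [X in _ && X]andbC.
rewrite (partition_big (fun U : {set 'I_n} => inord #|U| : 'I_n.+1) predT) //=.
apply: eq_bigr => m _.
rewrite (eq_bigl (fun U : {set 'I_n} => #|U| == m)); last first.
  by move=> U; rewrite -(inj_eq val_inj) /= inordK.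
rewrite (eq_bigr (fun=> fiber_card m k)) => [|U /eqP-> //].
rewrite (eq_bigl (fun U => U \in [set V : {set 'I_n} | #|V| == m])).
  by rewrite sum_nat_const card_draws card_ord.
by move=> U; rewrite inE.
Qed.

End Ordered.

(** * Rearranging the double sum into the stated form *)

Lemma sum_fiber_card n k :
  \sum_(m < n.+1) 'C(n, m) * fiber_card m k =
  k`! * 'C(n, 2 * k) + \sum_((2 * k).+1 <= m < n.+1) 'C(n, m) * (k`! * k).
Proof.
rewrite -(big_mkord xpredT (fun m => 'C(n, m) * fiber_card m k)).
have low a b : b <= 2 * k -> \sum_(a <= m < b) 'C(n, m) * fiber_card m k = 0.
  move=> bk; rewrite big_nat big1 // => m /andP[_ mb].
  by rewrite /fiber_card (leq_trans mb bk) muln0.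
have [kn|nk] := leqP (2 * k) n; last first.
  by rewrite low // bin_small // muln0 big_geq //; lia.
rewrite (@big_cat_nat _ _ _ (2 * k)) //=; last lia.
rewrite low // add0n big_ltn // {1}/fiber_card ltnn eqxx mulnC; congr (_ + _).
rewrite big_nat [RHS]big_nat; apply: eq_bigr => m /andP[km _].
by rewrite /fiber_card ltnNge (ltnW km) /= gtn_eqF.
Qed.

(** The terms with [m = 2 * k] agree directly. In the others [k] is shifted by one: [m > 2 * k.+1]
    becomes [m = 2 * k + l] with [l >= 3], and [k.+1]! * k.+1 = k[! * (k + 1) ^ 2]. *)
Lemma sum_fiber_card_reindex n :
  \sum_(k < n.+1) \sum_(m < n.+1) 'C(n, m) * fiber_card m k =
  \sum_(0 <= k < (n %/ 2).+1)
    (k`! * 'C(n, 2 * k) +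
     \sum_(3 <= l < (n - 2 * k).+1) 'C(n, 2 * k + l) * k`! * (k + 1) ^ 2).
Proof.
rewrite (eq_bigr _ (fun (k : 'I_n.+1) _ => sum_fiber_card n k)).
rewrite -(big_mkord xpredT (fun k => k`! * 'C(n, 2 * k) +
  \sum_((2 * k).+1 <= m < n.+1) 'C(n, m) * (k`! * k))).
rewrite (@big_cat_nat _ _ _ (n %/ 2).+1) //=; last lia.
rewrite [X in _ + X](_ : _ = 0) ?addn0; last first.
  rewrite big_nat big1 // => k /andP[nk _].
  by rewrite bin_small ?muln0 ?big_geq //; lia.
rewrite !big_split /=; congr (_ + _).
(* The shift leaves over the term [k = 0] on the left, zero by its factor [k], and the term
   [k = n %/ 2] on the right, whose inner sum is empty since [n - 2 * k <= 1]. *)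
rewrite big_nat_recl // [RHS]big_nat_recr //= [X in X + _](_ : _ = 0); last first.
  by rewrite big1 // => m _; rewrite !muln0.
rewrite [X in _ = _ + X]big_geq ?addn0 ?add0n; last lia.
rewrite big_nat [RHS]big_nat; apply: eq_bigr => k /andP[_ kn].
have -> : (2 * k.+1).+1 = 3 + 2 * k by lia.
have -> : n.+1 = (n - 2 * k).+1 + 2 * k by lia.
rewrite big_addn addnK; apply: eq_bigr => l _.
by rewrite addnC factS addn1; lia.
Qed.

(** * Blocks, fibers and standardization *)

Section PartitionsAndMaps.
Variable n : nat.
Implicit Types (P : {set {set 'I_n}}) (g : {ffun 'I_n -> 'I_n}).

Lemma eq_pblock_setT P x y : partition P setT ->
  (pblock P x == pblock P y) = (y \in pblock P x).
Proof. by case/and3P=> /eqP cP tP _; rewrite eq_pblock // cP inE. Qed.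

Lemma eq_pblock_preim g x y :
  (pblock (preim_partition g setT) x == pblock (preim_partition g setT) y) =
  (g x == g y).
Proof.
rewrite eq_pblock_setT ?preim_partitionP // pblock_equivalence_partition //.
by move=> u v w _ _ _; split=> // /eqP->.
Qed.

Lemma eq_preim_partition (T1 T2 : finType) (f : 'I_n -> T1) (h : 'I_n -> T2) :
  (forall x y, (f x == f y) = (h x == h y)) ->
  preim_partition f setT = preim_partition h setT.
Proof.
move=> fh; apply: eq_imset => x; apply/setP=> y.
by rewrite inE [RHS]inE fh.
Qed.

Lemma rank_in_ltn (S : {set 'I_n}) x y : rank_in S x < rank_in S y -> x < y.
Proof.
apply: contraTT; rewrite -!leqNgt => yx; apply/subset_leq_card/subsetP=> z.
by rewrite !inE => /andP[-> /leq_trans]; apply.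
Qed.

Lemma standardization_block k (S : {set 'I_n}) Q (T : {set 'I_k}) :
  T \in standardization k S Q ->
  exists2 B, B \in Q & forall i : 'I_k,
    i \in T <-> exists2 x, x \in B & rank_in S x = i.
Proof.
case/imsetP=> B BQ ->; exists B => // i; rewrite inE.
split=> [/exists_inP[x xB /eqP xi]|[x xB xi]]; first by exists x.
by apply/exists_inP; exists x; rewrite ?xi.
Qed.

Lemma restriction_mem P S B : B \in restriction P S ->
  exists2 B', B' \in P & B = B' :&: S.
Proof. by case/setDP=> /imsetP[B' PB' ->] _; exists B'. Qed.

Lemma pblock_restriction P S B x : partition P setT -> B \in restriction P S ->
  x \in B -> B = pblock P x :&: S.
Proof.
case/and3P=> _ tP _ /restriction_mem[B' PB' ->]; rewrite inE => /andP[xB' _].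
by rewrite (def_pblock tP PB' xB').
Qed.

(** * Occurrences of 12/34 in terms of blocks *)

Lemma contains_12_34P P : partition P setT ->
  reflect (exists a b c d : 'I_n, [/\ a < b, b < c & c < d] /\
             [/\ pblock P a = pblock P b, pblock P c = pblock P d &
                 pblock P a <> pblock P c])
          (contains P partition_12_34).
Proof.
move=> partP; apply: (iffP existsP).
  case=> S /andP[_ /eqP std].
  (* Each block of the pattern comes from a block of the restriction; [a], [b], [c], [d] are chosen
     there with ranks 0, 1, 2, 3, and ranks reflect the order. *)
  have blk T : T \in partition_12_34 -> T \in standardization 4 S (restriction P S).
    by rewrite std.
  have [|B1 B1R B1P] := standardization_block (blk [set inord 0; inord 1] _).
    by rewrite !inE eqxx.
  have [|B2 B2R B2P] := standardization_block (blk [set inord 2; inord 3] _).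
    by rewrite !inE eqxx orbT.
  have /B1P[a aB1] : inord 0 \in [set inord 0; inord 1 : 'I_4].
    by rewrite !inE eqxx.
  have /B1P[b bB1] : inord 1 \in [set inord 0; inord 1 : 'I_4].
    by rewrite !inE eqxx orbT.
  have /B2P[c cB2] : inord 2 \in [set inord 2; inord 3 : 'I_4].
    by rewrite !inE eqxx.
  have /B2P[d dB2] : inord 3 \in [set inord 2; inord 3 : 'I_4].
    by rewrite !inE eqxx orbT.
  rewrite !inordK // => rd rc rb ra.
  have B1E := pblock_restriction partP B1R aB1.
  have B2E := pblock_restriction partP B2R cB2.
  exists a, b, c, d; split; first by split; apply: (@rank_in_ltn S); lia.
  split.
  - by apply/eqP; rewrite eq_pblock_setT //; move: bB1; rewrite B1E inE => /andP[].
  - by apply/eqP; rewrite eq_pblock_setT //; move: dB2; rewrite B2E inE => /andP[].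
  (* If [a] and [c] shared a block, [c] would put its rank 2 into the standardized block of [a]. *)
  move=> ac; have : inord 2 \in [set inord 0; inord 1 : 'I_4].
    by apply/B1P; exists c; rewrite ?inordK // B1E ac -B2E.
  by rewrite !inE -!(inj_eq val_inj) /= !inordK.
case=> a [b [c [d [[ab bc cd] [pab pcd pac]]]]].
have ac := ltn_trans ab bc; have bd := ltn_trans bc cd.
have ad := ltn_trans ab bd.
pose S := [set a; b; c; d].
(* The comparisons of the four points are bundled as multi-rules, so that each later case check is a
   single rewrite. *)
have neq (x y : 'I_n) : x < y -> (x == y = false) * (y == x = false).
  by move=> xy; rewrite !(eq_sym y) -(inj_eq val_inj) ltn_eqF.
have neqs := (neq _ _ ab, neq _ _ bc, neq _ _ cd, neq _ _ ac, neq _ _ bd, neq _ _ ad).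
have rank (x : 'I_n) (T : {set 'I_n}) : T = [set y in S | y < x] -> rank_in S x = #|T|.
  by move->.
have lts (x y : 'I_n) : x < y -> (x < y = true) * (y < x = false).
  by move=> xy; rewrite xy ltnNge (ltnW xy).
have ltss := (lts _ _ ab, lts _ _ bc, lts _ _ cd, lts _ _ ac, lts _ _ bd, lts _ _ ad).
have inS (p : pred 'I_n) (T : {set 'I_n}) : (forall y, y \in S -> (y \in T) = p y) -> T \subset S ->
    T = [set y in S | p y].
  move=> Tp TS; apply/setP=> y; rewrite inE; have [yS|yS] := boolP (y \in S).
    by rewrite Tp.
  by apply/negP=> /(subsetP TS); apply/negP.
(* Each rank is the size of an explicit set of smaller elements: empty, then [[set a]], [[set a; b]]
   and [[set a; b; c]]. *)
have ra : rank_in S a = 0.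
  rewrite -(cards0 'I_n); apply/rank/inS; rewrite ?sub0set // => y.
  by rewrite !inE /= -!orbA => /or4P[] /eqP->; rewrite ?ltss ?ltnn.
have rb : rank_in S b = 1.
  rewrite -(cards1 a); apply/rank/inS => [y|]; last first.
    by apply/subsetP=> y; rewrite !inE => /eqP->; rewrite eqxx.
  by rewrite !inE /= -!orbA => /or4P[] /eqP->; rewrite ?ltss ?ltnn ?neqs ?eqxx.
have rc : rank_in S c = 2.
  rewrite (_ : 2 = #|[set a; b]|); last by rewrite cards2 neqs.
  apply/rank/inS => [y|]; last first.
    by apply/subsetP=> y; rewrite !inE => ->.
  by rewrite !inE /= -!orbA => /or4P[] /eqP->; rewrite ?ltss ?ltnn ?neqs ?eqxx.
have cS3 : #|[set a; b; c]| = 3.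
  by rewrite setUC cardsU1 cards2 !inE !neqs.
have rd : rank_in S d = 3.
  rewrite -cS3; apply/rank/inS => [y|]; last first.
    by apply/subsetP=> y; rewrite !inE => ->.
  by rewrite !inE /= -!orbA => /or4P[] /eqP->; rewrite ?ltss ?ltnn ?neqs ?eqxx.
have pin x y : (y \in pblock P x) = (pblock P x == pblock P y).
  by rewrite eq_pblock_setT.
have nac : (pblock P a == pblock P c = false) * (pblock P c == pblock P a = false).
  by split; apply/eqP => // /esym.
have restr_ab : pblock P a :&: S = [set a; b].
  apply/setP=> y; rewrite inE pin !inE; apply/idP/idP.
    by case/andP=> py; rewrite -!orbA => /or4P[] /eqP yE; move: py;
      rewrite yE -?pcd ?nac ?eqxx ?orbT.
  by case/orP=> /eqP->; rewrite -?pab !eqxx ?orbT.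
have restr_cd : pblock P c :&: S = [set c; d].
  apply/setP=> y; rewrite inE pin !inE; apply/idP/idP.
    by case/andP=> py; rewrite -!orbA => /or4P[] /eqP yE; move: py;
      rewrite yE -?pab ?nac ?eqxx ?orbT.
  by case/orP=> /eqP->; rewrite -?pcd !eqxx ?orbT.
have /and3P[/eqP cP _ _] := partP.
have in_restr x : x \in S -> pblock P x :&: S \in restriction P S.
  move=> xS; rewrite in_setD1; apply/andP; split.
    by apply/set0Pn; exists x; rewrite inE pin eqxx.
  by apply/imsetP; exists (pblock P x); rewrite ?pblock_mem ?cP.
have restrE : restriction P S = [set [set a; b]; [set c; d]].
  apply/setP=> E; rewrite in_set2; apply/idP/idP.
    move=> ER; have /set0Pn[y yE] : E != set0 by case/setD1P: ER.
    rewrite (pblock_restriction partP ER yE).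
    have : y \in S by case/restriction_mem: ER yE => B _ ->; case/setIP.
    rewrite !inE -!orbA => /or4P[] /eqP->;
      by rewrite -?pab -?pcd ?restr_ab ?restr_cd eqxx ?orbT.
  by case/orP=> /eqP->; rewrite -?restr_ab -?restr_cd in_restr // !inE eqxx ?orbT.
have stdE (x y : 'I_n) i j : rank_in S x = i -> rank_in S y = j -> i < 4 -> j < 4 ->
    [set k : 'I_4 | [exists z in [set x; y], rank_in S z == k]] =
    [set inord i; inord j].
  move=> xi yj i4 j4; apply/setP=> k; rewrite !inE.
  rewrite -!(inj_eq val_inj) /= !inordK // -xi -yj.
  apply/exists_inP/orP => [[z]|]; rewrite ?inE.
    by case/orP=> /eqP-> /eqP->; rewrite eqxx; [left|right].
  by case=> /eqP->; [exists x|exists y]; rewrite ?inE ?eqxx ?orbT.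
exists S; apply/andP; split.
  by rewrite /S setUC cardsU1 cS3 !inE !neqs.
rewrite /standardization restrE imsetU1 imset_set1 /partition_12_34.
by rewrite (stdE a b 0 1) // (stdE c d 2 3).
Qed.

(** * The bijection between avoiding maps and avoiding partitions *)

(** If [g] and [h] have the same fibers, then [h x] lies in the fiber of [x], so
    [g x = g (h x) <= h x]; the reverse inequality is symmetric. *)
Lemma preim_partition_block_min_inj :
  {in @avoiding_maps n &, injective (fun g => preim_partition g setT)}.
Proof.
have half (g h : {ffun 'I_n -> 'I_n}) : is_block_min g -> is_block_min h ->
    preim_partition g setT = preim_partition h setT -> forall x, g x <= h x.
  move=> /is_block_minP[gle _] /is_block_minP[_ hh] gh x.
  suff /eqP-> : g x == g (h x) by apply: gle.
  by rewrite -eq_pblock_preim gh eq_pblock_preim hh.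
move=> g h; rewrite !inE => /andP[gm _] /andP[hm _] gh.
by apply/ffunP=> x; apply/val_inj/eqP; rewrite /= eqn_leq !half.
Qed.

Lemma preim_partition_avoiding_maps :
  (fun g => preim_partition g setT) @: @avoiding_maps n =
  avoiding_partitions n partition_12_34.
Proof.
apply/setP=> P; rewrite [RHS]inE; apply/imsetP/andP.
  case=> g; rewrite inE => /andP[_ /avoids_split_pairsP av] ->.
  split; first exact: preim_partitionP.
  apply/contains_12_34P; first exact: preim_partitionP.
  case=> a [b [c [d [[ab bc cd] [/eqP pab /eqP pcd /eqP]]]]].
  move: pab pcd; rewrite !eq_pblock_preim => /eqP pab /eqP pcd; apply/negP.
  by rewrite negbK (av a b c d).
case=> partP /(contains_12_34P partP) av.
have pin x y : (y \in pblock P x) = (pblock P x == pblock P y).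
  by rewrite eq_pblock_setT.
(* The preimage of [P] sends [x] to the least element of its block; the starting point [x] of
   [arg min] does belong to that block. *)
pose g := [ffun x => [arg min_(y < x in pblock P x) (y : nat)]].
have gP x : pblock P (g x) = pblock P x /\
    forall y, pblock P x = pblock P y -> g x <= y.
  rewrite ffunE; case: arg_minnP => [|y]; first by rewrite pin.
  rewrite pin => /eqP <- ymin; split=> // z xz.
  by apply: ymin; rewrite pin xz.
(* The fibers of [g] are the blocks of [P], so both avoidance conditions translate into each
   other. *)
have kerg x y : (g x == g y) = (pblock P x == pblock P y).
  apply/eqP/eqP=> [gxy|pxy]; first by rewrite -(gP x).1 gxy (gP y).1.
  apply/val_inj/eqP; rewrite /= eqn_leq.
  by rewrite (gP x).2 ?(gP y).2 ?(gP x).1 ?(gP y).1.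
exists g; last by rewrite (eq_preim_partition kerg) preim_partition_pblock.
rewrite inE; apply/andP; split.
  apply/is_block_minP; split=> x; first exact: (gP x).2.
  by apply/eqP; rewrite kerg (gP x).1.
apply/avoids_split_pairsP=> a b c d ab bc cd /eqP; rewrite kerg => /eqP pab.
move/eqP; rewrite kerg => /eqP pcd; apply/eqP; rewrite kerg.
by apply/negPn/negP=> /eqP pac; apply: av; exists a, b, c, d.
Qed.

End PartitionsAndMaps.

Theorem theorem4p6 (n : nat) (n_ge1 : 1 <= n) :
  #|avoiding_partitions n partition_12_34| =
  \sum_(0 <= k < (n %/ 2).+1)
    (k`! * 'C(n, 2 * k) +
     \sum_(3 <= l < (n - 2 * k).+1) 'C(n, 2 * k + l) * k`! * (k + 1) ^ 2).
Proof.
rewrite -preim_partition_avoiding_maps card_in_imset.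
  by rewrite card_avoiding_maps sum_fiber_card_reindex.
exact: preim_partition_block_min_inj.
Qed.
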